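(* Let $K$ be a scattered and countably tight compact Hausdorff space. Then $C(K)$ has the countable separation property (CSP) if and only if $K$ is separable.
   Context: $C(K)$ is the Banach space of real-valued continuous functions on $K$ with the supremum norm. A topological space $K$ is countably tight if for each $A\subset K$ and $a\in\overline{A}$ there is a countable $A_0\subset A$ with $a\in\overline{A_0}$. For a Banach space $X$, a set $\mathcal{F}\subset X^*$ separates $X$ if for every $x\in X\setminus\{0\}$ there is $f\in\mathcal{F}$ with $f(x)\neq 0$; $X$ has CSP if every separating set $\mathcal{F}\subset X^*$ contains a countable subset that separates $X$. *)

(* Defs.v *)
From HB Require Import structures.
From mathcomp Require Import all_boot all_order all_algebra.
From mathcomp Require Import all_classical all_reals all_analysis.
From mathcomp Require Import lra.

Set Implicit Arguments.
Unset Strict Implicit.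
Unset Printing Implicit Defensive.

Import Order.TTheory GRing.Theory Num.Theory.
Import numFieldNormedType.Exports.

Local Open Scope classical_set_scope.
Local Open Scope ring_scope.

Definition scattered_space (K : topologicalType) : Prop :=
  forall A : set K, A !=set0 -> isolated A !=set0.

Definition countably_tight (K : topologicalType) : Prop :=
  forall (A : set K) (a : K), closure A a ->
    exists A0 : set K, [/\ A0 `<=` A, countable A0 & closure A0 a].

Definition separable_space (K : topologicalType) : Prop :=
  exists2 D : set K, countable D & dense D.

Definition dual (R : realType) (X : normedModType R) : set {scalar X} :=
  [set f : {scalar X} | continuous f].

Definition separates (R : realType) (X : normedModType R)
    (F : set {scalar X}) : Prop :=
  forall x : X, x != 0 -> exists2 f : {scalar X}, F f & f x != 0.

Definition CSP (R : realType) (X : completeNormedModType R) : Prop :=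
  forall F : set {scalar X}, F `<=` @dual R X -> separates F ->
    exists F0 : set {scalar X}, [/\ F0 `<=` F, countable F0 & separates F0].

(* The Banach space C(K).  The proof of compactness is a parameter of the type
   because the supremum norm is a norm only on bounded functions: [sup] is 0 on
   unbounded sets.  It is also 0 on the empty set, so that C(K) = {0} when K is
   empty.  A new name, rather than [continuousType K R] itself, keeps the norm
   topology apart from the topologies of [ArrowAsProduct] and the like. *)
Definition continuous_functions (R : realType) (K : topologicalType)
  (cK : compact [set: K]) : Type := continuousType K R.
Arguments continuous_functions R {K} cK.

Section continuous_functions_banach.
Context (R : realType) (K : topologicalType) (cK : compact [set: K]).
Local Notation CK := (continuous_functions R cK).

HB.instance Definition _ := Choice.copy CK (continuousType K R).

Definition cfun_eval (f : CK) : K -> R := (f : continuousType K R).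
Local Coercion cfun_eval : continuous_functions >-> Funclass.

Definition mk_cfun (f : K -> R) (cf : continuous f) : CK :=
  (mkcts cf : continuousType K R).

Lemma cfun_continuous (f : CK) : continuous f.
Proof. exact: (@cts_fun _ _ (f : continuousType K R)). Qed.

Lemma cfunP (f g : CK) : (forall x, f x = g x) -> f = g.
Proof. by move=> fg; apply/continuousEP. Qed.

Lemma cfun_zero_subproof : continuous (cst 0 : K -> R).
Proof. by move=> x; exact: cvg_cst. Qed.

Lemma cfun_opp_subproof (f : CK) : continuous (fun x => - f x).
Proof. by move=> x; apply: cvgN; exact: cfun_continuous. Qed.

Lemma cfun_add_subproof (f g : CK) : continuous (fun x => f x + g x).
Proof. by move=> x; apply: cvgD; exact: cfun_continuous. Qed.

Lemma cfun_scale_subproof (a : R) (f : CK) : continuous (fun x => a * f x).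
Proof. by move=> x; apply: cvgM; [exact: cvg_cst|exact: cfun_continuous]. Qed.

Definition cfun_zero : CK := mk_cfun cfun_zero_subproof.
Definition cfun_opp (f : CK) : CK := mk_cfun (@cfun_opp_subproof f).
Definition cfun_add (f g : CK) : CK := mk_cfun (@cfun_add_subproof f g).
Definition cfun_scale (a : R) (f : CK) : CK :=
  mk_cfun (@cfun_scale_subproof a f).

Lemma cfun_addA : associative cfun_add.
Proof. by move=> f g h; apply: cfunP => x; exact: addrA. Qed.

Lemma cfun_addC : commutative cfun_add.
Proof. by move=> f g; apply: cfunP => x; exact: addrC. Qed.

Lemma cfun_add0 : left_id cfun_zero cfun_add.
Proof. by move=> f; apply: cfunP => x; exact: add0r. Qed.

Lemma cfun_addN : left_inverse cfun_zero cfun_opp cfun_add.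
Proof. by move=> f; apply: cfunP => x; exact: addNr. Qed.

HB.instance Definition _ :=
  GRing.isZmodule.Build CK cfun_addA cfun_addC cfun_add0 cfun_addN.

Lemma cfun_scaleA a b (f : CK) :
  cfun_scale a (cfun_scale b f) = cfun_scale (a * b) f.
Proof. by apply: cfunP => x; exact: mulrA. Qed.

Lemma cfun_scale1 : left_id 1 cfun_scale.
Proof. by move=> f; apply: cfunP => x; exact: mul1r. Qed.

Lemma cfun_scaleDr : right_distributive cfun_scale +%R.
Proof. by move=> a f g; apply: cfunP => x; exact: mulrDr. Qed.

Lemma cfun_scaleDl (f : CK) : {morph cfun_scale^~ f : a b / a + b}.
Proof. by move=> a b; apply: cfunP => x; exact: mulrDl. Qed.

HB.instance Definition _ := GRing.Zmodule_isLmodule.Build R CK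
  cfun_scaleA cfun_scale1 cfun_scaleDr cfun_scaleDl.

Definition sup_norm (f : CK) : R := sup [set `|f x| | x in [set: K]].

Lemma sup_norm_has_ubound (f : CK) :
  has_ubound [set `|f x| | x in [set: K]].
Proof.
have /compact_bounded[M [_ fM]] : compact (cfun_eval f @` [set: K]).
  apply: continuous_compact => //.
  by apply: continuous_subspaceT; exact: cfun_continuous.
exists (M + 1) => _ [x _ <-]; apply: (fM (M + 1)); first by rewrite ltrDl.
by exists x.
Qed.

Lemma le_sup_norm (f : CK) (x : K) : `|f x| <= sup_norm f.
Proof. by apply: ub_le_sup; [exact: sup_norm_has_ubound|exists x]. Qed.

Lemma sup_norm_ge0 (f : CK) : 0 <= sup_norm f.
Proof.
have [[x _]|K0] := pselect ([set: K] !=set0).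
  exact: le_trans (normr_ge0 _) (le_sup_norm f x).
rewrite /sup_norm (_ : [set `|f x| | x in [set: K]] = set0) ?sup0//.
by rewrite -subset0 => y [x _ _]; apply: K0; exists x.
Qed.

Lemma sup_norm_le (f : CK) (M : R) :
  0 <= M -> (forall x, `|f x| <= M) -> sup_norm f <= M.
Proof.
move=> M0 fM; have [[x _]|K0] := pselect ([set: K] !=set0).
  apply: ge_sup; first by exists `|f x|; exists x.
  by move=> _ [y _ <-].
rewrite /sup_norm (_ : [set `|f x| | x in [set: K]] = set0) ?sup0//.
by rewrite -subset0 => y [x _ _]; apply: K0; exists x.
Qed.

Lemma ler_sup_normD (f g : CK) : sup_norm (f + g) <= sup_norm f + sup_norm g.
Proof.
apply: sup_norm_le => [|x]; first by rewrite addr_ge0// sup_norm_ge0.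
exact: le_trans (ler_normD _ _) (lerD (le_sup_norm f x) (le_sup_norm g x)).
Qed.

Lemma sup_normZ (a : R) (f : CK) : sup_norm (a *: f) = `|a| * sup_norm f.
Proof.
have le_normZ (b : R) (g : CK) : sup_norm (b *: g) <= `|b| * sup_norm g.
  apply: sup_norm_le => [|x]; first by rewrite mulr_ge0// sup_norm_ge0.
  by rewrite [X in `|X|](_ : _ = b * g x)// normrM ler_wpM2l// le_sup_norm.
apply/eqP; rewrite eq_le le_normZ /=.
have [->|a0] := eqVneq a 0; first by rewrite normr0 mul0r sup_norm_ge0.
rewrite -ler_pdivlMl ?normr_gt0// -normfV.
by have := le_normZ a^-1 (a *: f); rewrite scalerA mulVf// scale1r.
Qed.

Lemma sup_norm_eq0 (f : CK) : sup_norm f = 0 -> f = 0.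
Proof.
move=> f0; apply: cfunP => x; apply/normr0_eq0/eqP.
by rewrite eq_le normr_ge0 andbT -f0 le_sup_norm.
Qed.

HB.instance Definition _ :=
  Lmodule_isNormed.Build R CK ler_sup_normD sup_normZ sup_norm_eq0.

Lemma cfun_normE (f : CK) : `|f| = sup [set `|f x| | x in [set: K]].
Proof. by []. Qed.

Lemma cfun_cauchy_cvg (F : set_system CK) : ProperFilter F -> cauchy F -> cvg F.
Proof.
move=> FF /cauchyP F_cauchy.
have ballx (f h : CK) (e : R) (x : K) : ball f e h -> `|f x - h x| < e.
  rewrite -ball_normE /= cfun_normE; apply: le_lt_trans.
  exact: (le_sup_norm (f - h) x).
have cvgx (x : K) : cvg ((fun f : CK => f x) @ F).
  apply/cauchy_cvgP/cauchy_exP => e /F_cauchy[f0 Ff0]; exists (f0 x).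
  rewrite /fmapE -ball_normE /=; apply: filterS Ff0 => f; exact: ballx.
pose g (x : K) : R := lim ((fun f : CK => f x) @ F).
have gP (e : R) (f0 : CK) (x : K) : F (ball f0 e) -> `|f0 x - g x| <= e.
  move=> Ff0; apply/ler_addgt0Pr => d d0.
  have /cvgrPdist_lt/(_ _ d0) gd := cvgx x.
  have [f [f0f gf]] := filter_ex (filterI Ff0 gd).
  rewrite -(subrKA (f x)) (le_trans (ler_normD _ _))// lerD//.
    by rewrite ltW// ballx.
  by rewrite distrC ltW.
have cg : continuous g.
  move=> x; apply/cvgrPdist_lt => e e0.
  have e3 : 0 < e / 3 by rewrite divr_gt0.
  have [f0 Ff0] := F_cauchy _ e3.
  have /cvgrPdist_lt/(_ _ e3) := @cfun_continuous f0 x.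
  apply: filterS => y xy.
  rewrite [e](_ : _ = e / 3 + (e / 3 + e / 3)); last by lra.
  rewrite -(subrKA (f0 x)) (le_lt_trans (ler_normD _ _))// ler_ltD//.
    by rewrite distrC gP.
  rewrite -(subrKA (f0 y)) (le_lt_trans (ler_normD _ _))// ltr_leD//.
  exact: gP.
apply/cvg_ex; exists (mk_cfun cg : CK).
apply/cvgrPdist_le => e e0; have e2 : 0 < e / 2 by rewrite divr_gt0.
have [f0 Ff0] := F_cauchy _ e2.
apply: filterS (Ff0) => f f0f; rewrite cfun_normE; apply: sup_norm_le => [|x].
  exact: ltW.
rewrite [X in `|X|](_ : _ = g x - f x)// [e]splitr -(subrKA (f0 x)).
rewrite (le_trans (ler_normD _ _))// lerD//; first by rewrite distrC gP.
by rewrite ltW// ballx.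
Qed.

HB.instance Definition _ := Uniform_isComplete.Build CK cfun_cauchy_cvg.

End continuous_functions_banach.

(* Main.v *)
Require Import Defs.
From HB Require Import structures.
From mathcomp Require Import all_boot all_order all_algebra.
From mathcomp Require Import all_classical all_reals all_analysis.
From mathcomp Require Import lra.

Set Implicit Arguments.
Unset Strict Implicit.
Unset Printing Implicit Defensive.

Import Order.TTheory GRing.Theory Num.Theory.
Import numFieldNormedType.Exports.

Local Open Scope classical_set_scope.
Local Open Scope ring_scope.

(** If C(K) has CSP, then countably many of the evaluations at points of K
    separate C(K), and by Urysohn's lemma their points form a dense set.

    Conversely, let K be separable and let F be a separating set of functionals
    without countable separating subset.  Every countable part of F then kills a
    function that takes the value 1 at some point of a fixed countable dense
    set.  The countable parts of F are directed under countable unions, so one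
    point d serves all of them ([countable_pigeonhole]).  Hence the closed
    convex sets {x | x d = 1} and {x | f x = 0}, for f in F, have the countable
    intersection property.  If C(K) has Corson's property (C), that is, if every
    family of closed convex sets with the countable intersection property has a
    common point ([corson_property]), then some x kills F and satisfies x d = 1:
    F does not separate.

    For property (C) it suffices to show that a convex family T with the
    countable intersection property keeps it after some closed ball of a given
    radius e is added ([cip_near_point]): balls of radii tending to 0 yield a
    Cauchy filter, and its limit is the common point.  Suppose that every ball of
    radius e destroys the property.  Let M be the set of functionals of norm at
    most 1 that are at least e on the intersection of some countable part of T.
    Then (i) any countable subset of M is at least e at a common function, by the
    countable intersection property; and (ii) any countable set of functions is
    killed by some element of M, because its closed span is separable, hence at
    distance at least e from the intersection of some countable part of T, and
    the Hahn-Banach theorem applies ([far_from_countable_functional]).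

    The hypotheses on K make (i) and (ii) contradictory.  As K is scattered, all
    functionals are norm limits of finite combinations of evaluations
    ([atomic_approximation]).  By the pigeonhole principle again, (i) holds for
    functions bounded by some N, and (ii) for functionals that are close to
    combinations with one fixed list of n rational coefficients.  Such
    combinations are parametrized by a compact space Z, a product of K^n with a
    finite space.  On Z, (i) says that for any countable set of parameters some
    function is large at all of them, and (ii) that for any countable set of
    functions some parameter makes all of them small.  But Z is countably tight
    because K is ([countably_tight_prod]), and in a compact countably tight space
    (i) and (ii) exclude each other ([no_countably_separating_duality]). *)

(** * Countable sets *)

Lemma countable_gather (I T : Type) (C : set I) (A : set T)
    (Q : I -> set T -> Prop) :
  countable C ->
  (forall i, C i -> exists D, [/\ D `<=` A, countable D & Q i D]) ->
  exists E : I -> set T, [/\ forall i, C i -> Q i (E i),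
    \bigcup_(i in C) E i `<=` A & countable (\bigcup_(i in C) E i)].
Proof.
move=> cC exD.
have /choice[E EP] : forall i, exists D, C i ->
    [/\ D `<=` A, countable D & Q i D].
  move=> i; have [/exD[D DP]|nCi] := pselect (C i); first by exists D.
  by exists set0.
exists E; split=> [i /EP[]//|x [i /EP[EA _ _] /EA]//|].
by apply: bigcup_countable => // i /EP[].
Qed.

(** Countable subsets of [A] are closed under countable unions: if each index
    failed on its own countable subset, all would fail on the union. *)
Lemma countable_pigeonhole (I T : Type) (D : set I) (A : set T)
    (P : I -> set T -> Prop) :
  countable D -> (forall i B C, B `<=` C -> P i C -> P i B) ->
  (forall C, C `<=` A -> countable C -> exists2 i, D i & P i C) ->
  exists2 i, D i & forall C, C `<=` A -> countable C -> P i C.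
Proof.
move=> cD Pmono exP; apply: contrapT => noP.
have bad i : D i -> exists C, [/\ C `<=` A, countable C & ~ P i C].
  move=> Di; apply: contrapT => noC; apply: noP; exists i => // C CA cC.
  by apply: contrapT => nP; apply: noC; exists C.
have [E [nPE EA cE]] := countable_gather cD bad.
have [i Di] := exP _ EA cE; have := nPE i Di.
by apply: contra_not; apply: Pmono; exact: bigcup_sup.
Qed.

(** * Countable tightness of compact spaces *)

Section countable_tightness.
Implicit Types K L Z : topologicalType.

Definition countably_closed Z (A : set Z) : Prop :=
  forall C, C `<=` A -> countable C -> closure C `<=` A.

Lemma tight_countably_closed Z (A : set Z) :
  countably_tight Z -> countably_closed A -> closure A `<=` A.
Proof. by move=> tZ cA a /tZ[C [CA cC]]; exact: cA. Qed.

(** The union of the closures of the countable subsets of [A] is countably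
    closed, so it is closed under the hypothesis and hence contains the closure
    of [A].  This is the form in which tightness passes to products. *)
Lemma countably_closed_tight Z :
  (forall A : set Z, countably_closed A -> closure A `<=` A) ->
  countably_tight Z.
Proof.
move=> ccl A a Aa.
pose B : set Z := [set x | exists D, [/\ D `<=` A, countable D & closure D x]].
have cB : countably_closed B.
  move=> C CB cC x Cx.
  have [E [CE EA cE]] :=
    @countable_gather _ _ C A (fun i D => closure D i) cC CB.
  exists (\bigcup_(i in C) E i); split => //.
  apply: (closed_closure _); apply: closureS Cx => c Cc.
  by apply: closureS (CE c Cc); exact: bigcup_sup.
apply: (ccl _ cB); apply: closureS Aa => x Ax.
exists [set x]; split; [by move=> _ -> | exact: countable1 |].
exact: subset_closure.
Qed.

(** The projection along a compact factor is a closed map. *)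
Lemma closure_snd_compact K L (E : set (K * L)) (b : L) :
  compact [set: K] -> closed E -> closure [set p.2 | p in E] b ->
  exists a, E (a, b).
Proof.
move=> cK clE Eb.
pose S (V : set L) := [set a | exists2 b', V b' & E (a, b')].
have FF : Filter (filter_from (nbhs b) S).
  apply: filter_from_filter; first by exists setT; exact: filterT.
  move=> V W bV bW; exists (V `&` W); first exact: filterI.
  by move=> a [b' [Vb Wb] Eab]; split; exists b'.
have PF : ProperFilter (filter_from (nbhs b) S).
  apply: filter_from_proper => V /Eb[b' [[[a b''] Eab /= <-] Vb]].
  by exists a, b''.
have [|a [_ aF]] := cK _ PF; first exact: filterT.
exists a; apply: clE => U [] [V W] /= [aV bW] VWU.
have [|a' [[b' Wb Eab] Va]] := aF (S W) V _ aV; first by exists W.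
by exists (a', b'); split=> //; apply: VWU.
Qed.

(** Let (a, b) be in the closure of a countably closed set A.  For every closed
    neighbourhood N' of a, the projection to L of the part of A above N' is
    countably closed, since the projection is a closed map; so it contains b.
    Thus a is adherent to the fibre of A over b, which is countably closed, and
    (a, b) is in A. *)
Lemma countably_tight_prod K L : compact [set: K] -> hausdorff_space K ->
  countably_tight K -> countably_tight L -> countably_tight (K * L)%type.
Proof.
move=> cK hK tK tL; apply: countably_closed_tight => A cA [a b] Aab.
have fibre N : nbhs a N -> exists2 a', A (a', b) & N a'.
  move=> /(compact_regular hK cK (@filterT _ _ _))[N' aN' N'N].
  pose A' := A `&` (fst @^-1` closure N').
  suff [[a' b'] [Aab' Na'] /= eb] : [set p.2 | p in A'] b.
    by rewrite eb in Aab'; exists a' => //; exact: N'N.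
  apply: (tight_countably_closed tL) => [C CA' cC b' Cb'|V bV].
    have /choice[f fP] : forall c, exists p, C c -> A' p /\ p.2 = c.
      move=> c; have [/CA'[p A'p pc]|nCc] := pselect (C c).
        by exists p.
      by exists (a, c).
    have fA' : f @` C `<=` A' by move=> _ [c /fP[A'fc _] <-].
    have [|a' fCab] := @closure_snd_compact K L (closure (f @` C)) b' cK
      (@closed_closure _ _).
      apply: closureS Cb' => c Cc; exists (f c); last by have [] := fP _ Cc.
      by apply: subset_closure; exists c.
    exists (a', b') => //; split.
      apply: (cA (f @` C)) => //; first by move=> p /fA'[].
      exact: sub_countable (card_image_le _ _) cC.
    have clN : closed (@fst K L @^-1` closure N').
      by apply: preimage_closed (@closed_closure _ _) => p _; exact: cvg_fst.
    by apply: clN; apply: closureS fCab => p /fA'[].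
  have [|[a' b'] [Aab' [Na' Vb']]] := Aab (N' `*` V); first by exists (N', V).
  exists b'; split=> //; exists (a', b') => //; split=> //.
  exact: subset_closure.
suff : [set a' | A (a', b)] a by [].
apply: (tight_countably_closed tK) => [C CA cC a' Ca'|N /fibre[a' Aa' Na']].
  apply: (cA [set (c, b) | c in C]).
  - by move=> _ [c /CA ? <-].
  - exact: sub_countable (card_image_le _ _) cC.
  - move=> U [] [V W] /= [aV bW] VWU.
    have [c [Cc Vc]] := Ca' _ aV.
    exists (c, b); split; first by exists c.
    by apply: VWU; split => //=; exact: nbhs_singleton.
by exists a'.
Qed.

(** The sets {z in A | f z <= a for all f in G}, G countable, generate a proper
    filter.  A cluster point p of it is adherent to A, hence to a countable part
    C of A; the function f that is at least b on C satisfies both b <= f p and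
    f p <= a.  This is the argument that a compact countably
    tight space has no uncountable free sequence, with countable subsets in the
    place of countable ordinals. *)
Lemma no_countably_separating_duality (R : realType) Z (A : set Z)
    (F : set (Z -> R)) (a b : R) :
  compact [set: Z] -> countably_tight Z -> (forall f, F f -> continuous f) ->
  a < b ->
  (forall C, C `<=` A -> countable C ->
    exists2 f, F f & forall z, C z -> b <= f z) ->
  (forall G, G `<=` F -> countable G ->
    exists2 z, A z & forall f, G f -> f z <= a) ->
  False.
Proof.
move=> cZ tZ cF ab above below.
pose D : set (set (Z -> R)) := [set G | G `<=` F /\ countable G].
pose S (G : set (Z -> R)) := A `&` [set z | forall f, G f -> f z <= a].
have FF : Filter (filter_from D S).
  apply: filter_from_filter.
    by exists set0; split => //; exact: countable0.
  move=> G H [GF cG] [HF cH]; exists (G `|` H).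
    split; first by move=> f [/GF|/HF].
    rewrite -bigcup2E; apply: bigcup_countable; first exact: countableP.
    by move=> [|[|i]] _ //=; exact: countable0.
  by move=> z [Az Gz]; split; split=> // f ?; apply: Gz; [left|right].
have PF : ProperFilter (filter_from D S).
  apply: filter_from_proper => G [GF cG].
  by have [z Az zG] := below _ GF cG; exists z.
have [|p [_ pS]] := cZ _ PF; first exact: filterT.
have clf f : F f -> closed [set z | f z <= a] /\ closed [set z | b <= f z].
  move=> Ff; split.
    by apply: preimage_closed (@closed_le _ a) => z _; exact: cF.
  by apply: preimage_closed (@closed_ge _ b) => z _; exact: cF.
have /tZ[C [CA cC Cp]] : closure A p.
  move=> U pU; have [|z [[Az _] Uz]] := pS (S set0) U _ pU; last by exists z.
  by exists set0 => //; split => //; exact: countable0.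
have [f Ff fC] := above _ CA cC.
have [cla clb] := clf f Ff.
have fpb : b <= f p.
  rewrite -[is_true _]/([set z | b <= f z] p).
  by apply: clb; apply: closureS Cp.
have fpa : f p <= a.
  rewrite -[is_true _]/([set z | f z <= a] p).
  apply: cla => U pU; have [|z [[_ zf] Uz]] := pS (S [set f]) U _ pU.
    by exists [set f] => //; split; [move=> _ ->|exact: countable1].
  by exists z; split=> //; exact: zf.
by move: ab; rewrite ltNge (le_trans fpb fpa).
Qed.

End countable_tightness.

(** * The Hahn-Banach theorem *)

Section sublinear.
Context (R : realType) (V : lmodType R).
Implicit Types (p q : V -> R) (W : set (V * R)).

Definition sublinear q : Prop :=
  (forall x y, q (x + y) <= q x + q y) /\
  (forall a x, 0 < a -> q (a *: x) = a * q x).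

Definition convex_cone W : Prop :=
  [/\ W (0, 0),
      forall v w, W v -> W w -> W (v.1 + w.1, v.2 + w.2) &
      forall a v, 0 < a -> W v -> W (a *: v.1, a * v.2)].

Lemma sublinear0 q : sublinear q -> q 0 = 0.
Proof.
move=> [_ qZ]; have := qZ 2 0 (ltr0n _ 2); rewrite scaler0 => q00; lra.
Qed.

Lemma sublinear_opp q x : sublinear q -> - q (- x) <= q x.
Proof.
move=> qs; have := qs.1 x (- x); rewrite subrr sublinear0//; lra.
Qed.

(** The largest sublinear function below [q] that is at most [- w.2] at
    [- w.1] for all [w] in the cone [W]. *)
Definition inf_shift q W x : R := inf [set q (x + w.1) - w.2 | w in W].

Lemma inf_shift_sublinear q W : sublinear q -> convex_cone W ->
    (forall w, W w -> w.2 <= q w.1) ->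
  [/\ sublinear (inf_shift q W), forall x, inf_shift q W x <= q x &
      forall w, W w -> inf_shift q W (- w.1) <= - w.2].
Proof.
move=> qs [W0 WD WZ] Wq.
have lbW x w : W w -> - q (- x) <= q (x + w.1) - w.2.
  move=> /Wq wq; have := qs.1 (x + w.1) (- x).
  by rewrite addrAC subrr add0r; lra.
have infW x w : W w -> inf_shift q W x <= q (x + w.1) - w.2.
  move=> Ww; apply: ge_inf; last by exists w.
  by exists (- q (- x)) => _ [w' /lbW ? <-].
have lb_inf x c : (forall w, W w -> c <= q (x + w.1) - w.2) ->
    c <= inf_shift q W x.
  move=> cW; apply: lb_le_inf; first by exists (q (x + 0) - 0), (0, 0).
  by move=> _ [w /cW ? <-].
have shiftZ a x : 0 < a -> inf_shift q W (a *: x) <= a * inf_shift q W x.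
  move=> a0; rewrite -ler_pdivrMl//; apply: (lb_inf) => w Ww.
  rewrite ler_pdivrMl// mulrBr -qs.2// scalerDr.
  exact: (infW _ (a *: w.1, a * w.2) (WZ _ _ a0 Ww)).
split.
- split=> [x y|a x a0].
    rewrite -lerBlDr; apply: (lb_inf) => w Ww.
    suff : inf_shift q W (x + y) - (q (x + w.1) - w.2) <= inf_shift q W y.
      by lra.
    apply: (lb_inf) => w' Ww'.
    rewrite lerBlDr (le_trans (infW _ _ (WD _ _ Ww Ww')))//=.
    have := qs.1 (x + w.1) (y + w'.1); rewrite addrACA; lra.
  apply/eqP; rewrite eq_le shiftZ//=.
  rewrite -ler_pdivlMl// (le_trans _ (shiftZ _ _ _)) ?invr_gt0//.
  by rewrite scalerA mulVf ?scale1r ?gt_eqF.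
- by move=> x; have := infW x _ W0; rewrite addr0 subr0.
- move=> w Ww; have := infW (- w.1) _ Ww.
  by rewrite addNr sublinear0// sub0r.
Qed.

(** Sublinear functions below [p] are pointwise bounded below, by
    [x |-> - p (- x)], so that infima of chains exist and Zorn's lemma applies. *)
Lemma sublinear_minimal p : sublinear p ->
  exists2 q, sublinear q /\ (forall x, q x <= p x) &
    forall q', sublinear q' -> (forall x, q' x <= q x) -> q' = q.
Proof.
move=> ps.
pose T := {q : V -> R | sublinear q /\ (forall x, q x <= p x)}.
pose le (q q' : T) := `[< forall x, sval q' x <= sval q x >].
have pT : sublinear p /\ (forall x, p x <= p x) by [].
have [||||q qmin] := @Zorn T le.
- by move=> q; apply/asboolP.
- move=> q r s /asboolP qr /asboolP rs; apply/asboolP => x.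
  exact: le_trans (rs x) (qr x).
- move=> [q qT] [r rT] /asboolP/= qr /asboolP/= rq; apply/eq_exist/funext => x.
  by apply/eqP; rewrite eq_le qr rq.
- move=> A tA; have [[q0 Aq0]|A0] := pselect (A !=set0); last first.
    by exists (exist _ p pT) => s As; case: A0; exists s.
  pose m x := inf [set sval (q : T) x | q in A].
  have hm (q : T) x : A q -> m x <= sval q x.
    move=> Aq; apply: ge_inf; last by exists q.
    exists (- p (- x)) => _ [r _ <-]; have [rs rp] := svalP r.
    by apply: le_trans (sublinear_opp _ rs); rewrite lerN2.
  have mh c x : (forall q : T, A q -> c <= sval q x) -> c <= m x.
    move=> cA; apply: lb_le_inf; first by exists (sval q0 x), q0.
    by move=> _ [q /cA ? <-].
  have mZ a x : 0 < a -> m (a *: x) <= a * m x.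
    move=> a0; rewrite -ler_pdivrMl//; apply: (mh) => q Aq.
    by rewrite ler_pdivrMl// -(svalP q).1.2//; exact: hm.
  have mT : sublinear m /\ (forall x, m x <= p x).
    split; last by move=> x; apply: le_trans (hm q0 x Aq0) ((svalP q0).2 x).
    split=> [x y|a x a0].
      rewrite -lerBlDr; apply: (mh) => q Aq.
      suff : m (x + y) - sval q x <= m y by lra.
      apply: (mh) => r Ar.
      rewrite lerBlDr; have [/asboolP rq|/asboolP rq] := tA q r Aq Ar.
        apply: le_trans (hm r _ Ar) _; apply: le_trans ((svalP r).1.1 x y) _.
        by rewrite addrC lerD2l.
      apply: le_trans (hm q _ Aq) _; apply: le_trans ((svalP q).1.1 x y) _.
      by rewrite addrC lerD2r.
    apply/eqP; rewrite eq_le mZ//=.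
    rewrite -ler_pdivlMl// (le_trans _ (mZ _ _ _)) ?invr_gt0//.
    by rewrite scalerA mulVf ?scale1r ?gt_eqF.
  by exists (exist _ m mT) => q Aq; apply/asboolP => x; exact: hm.
exists (sval q); first exact: (svalP q).
move=> q' q's q'q.
have q'T : sublinear q' /\ (forall x, q' x <= p x).
  by split=> // x; exact: le_trans (q'q x) ((svalP q).2 x).
by rewrite -(qmin (exist _ q' q'T))//; exact/asboolP.
Qed.

Lemma sublinear_additive_linear q : sublinear q ->
  (forall x y, q (x + y) = q x + q y) -> exists f : {scalar V}, f =1 q.
Proof.
move=> qs qD.
have qN x : q (- x) = - q x.
  by apply/eqP; rewrite -addr_eq0 -qD addNr sublinear0.
have qZ a x : q (a *: x) = a * q x.
  have [a0|a0|->] := ltgtP a 0; last by rewrite scale0r mul0r sublinear0.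
  - by rewrite -[a]opprK scaleNr qN qs.2 ?oppr_gt0// !mulNr.
  - exact: qs.2.
have lq : linear_for *%R q by move=> a x y; rewrite qD qZ.
pose m := GRing.isLinear.Build R V R *%R q lq.
pose f : {scalar V} := HB.pack q m.
by exists f.
Qed.

(** A minimal sublinear function q below [inf_shift p W] is linear: shifting q
    along the ray through (y, q y) does not change q, by minimality, and this
    forces q (- y) = - q y. *)
Lemma hahn_banach_cone p W : sublinear p -> convex_cone W ->
    (forall w, W w -> w.2 <= p w.1) ->
  exists f : {scalar V},
    (forall x, f x <= p x) /\ (forall w, W w -> w.2 <= f w.1).
Proof.
move=> ps cW Wp.
have [p's p'p p'W] := inf_shift_sublinear ps cW Wp.
have [q [qs qp'] qmin] := sublinear_minimal p's.
have qD x y : q (x + y) = q x + q y.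
  pose Y := [set (t *: y, t * q y) | t in [set t | 0 <= t]].
  have cY : convex_cone Y.
    split; first by exists 0; rewrite /= ?scale0r ?mul0r.
      move=> _ _ [t /= t0 <-] [s /= s0 <-]; exists (t + s) => /=.
        exact: addr_ge0.
      by rewrite scalerDl mulrDl.
    move=> a _ a0 [t /= t0 <-]; exists (a * t).
      by rewrite /= mulr_ge0// ltW.
    by rewrite /= scalerA mulrA.
  have Yq w : Y w -> w.2 <= q w.1.
    move=> [t /= + <-] /=; rewrite le_eqVlt => /predU1P[<-|t0].
      by rewrite mul0r scale0r sublinear0.
    by rewrite qs.2.
  have [ss sq sY] := inf_shift_sublinear qs cY Yq.
  have sE := qmin _ ss sq.
  have Y1 : Y (y, q y) by exists 1; rewrite /= ?scale1r ?mul1r.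
  have := sY _ Y1; rewrite sE /= => qNy.
  have := qs.1 (x + y) (- y); rewrite addrK => qx.
  apply/eqP; rewrite eq_le qs.1 /=; lra.
have [f fq] := sublinear_additive_linear qs qD.
have fp' x : f x <= inf_shift p W x by rewrite fq.
exists f; split=> [x|w Ww]; first exact: le_trans (fp' x) (p'p x).
have := le_trans (fp' (- w.1)) (p'W w Ww).
by rewrite linearN/= lerN2.
Qed.

End sublinear.

Lemma convex_setP (R : realType) (V : lmodType R) (A : set V) :
  convex_set A <-> forall x y (t : R), A x -> A y -> 0 <= t <= 1 ->
    A (t *: x + (1 - t) *: y).
Proof.
split=> [cA x y t Ax Ay /andP[t0 t1]|cA x y t /set_mem Ax /set_mem Ay].
  exact: set_mem (cA x y (Itv01 t0 t1) (mem_set Ax) (mem_set Ay)).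
by apply/mem_set/(cA x y t%:num) => //; rewrite ge0 le1.
Qed.

(** The norm dominates the height [s * e] on the cone of all
    [(s *: t - l, s * e)]; the conclusions come from the rays [s = 1, l = 0] and
    [s = 0]. *)
Lemma separate_convex_subspace (R : realType) (X : normedModType R)
    (T L : set X) (e : R) :
  convex_set T -> T !=set0 ->
  L 0 -> (forall a x y, L x -> L y -> L (a *: x + y)) ->
  (forall t l, T t -> L l -> e <= `|t - l|) ->
  exists f : {scalar X}, [/\ forall x, `|f x| <= `|x|,
    forall l, L l -> f l = 0 & forall t, T t -> e <= f t].
Proof.
move=> /convex_setP cT [t0 Tt0] L0 Llin dTL.
have LZ a x : L x -> L (a *: x).
  by move=> Lx; rewrite -[_ *: _]addr0; apply: Llin.
have LD x y : L x -> L y -> L (x + y).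
  by move=> Lx Ly; rewrite -[x]scale1r; apply: Llin.
pose W : set (X * R) := [set w | exists s t l,
  [/\ 0 <= s, T t, L l & w = (s *: t - l, s * e)]].
have cW : convex_cone W.
  split.
  - by exists 0, t0, 0; split=> //; rewrite scale0r mul0r subr0.
  - move=> _ _ [s [t [l [s_ge0 Tt Ll ->]]]]
      [s' [t' [l' [s'_ge0 Tt' Ll' ->]]]] /=.
    (* At s = s' = 0 the convex combination of t and t' is undefined. *)
    have [ss'0|ss'0] := eqVneq (s + s') 0.
      exists 0, t, (l + l'); split=> //; first exact: LD.
      have -> : s = 0 by lra.
      have -> : s' = 0 by lra.
      by rewrite !scale0r !mul0r !sub0r addr0 opprD.
    have ss'_gt0 : 0 < s + s' by rewrite lt0r ss'0 addr_ge0.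
    exists (s + s'), ((s / (s + s')) *: t + (1 - s / (s + s')) *: t'), (l + l').
    split; [exact: addr_ge0| |exact: LD|].
      apply: cT => //; rewrite divr_ge0//=; last exact: ltW.
      by rewrite ler_pdivrMr// mul1r lerDl.
    have sE : (s + s') * (s / (s + s')) = s by rewrite mulrCA divff// mulr1.
    have s'E : (s + s') * (1 - s / (s + s')) = s' by rewrite mulrBr sE; lra.
    by rewrite scalerDr !scalerA sE s'E opprD addrACA mulrDl.
  - move=> a _ a0 [s [t [l [s_ge0 Tt Ll ->]]]] /=.
    exists (a * s), t, (a *: l); split=> //; [|exact: LZ|].
      by rewrite mulr_ge0// ltW.
    by rewrite scalerBr scalerA mulrA.
have Wn w : W w -> w.2 <= `|w.1|.
  move=> [s [t [l [+ Tt Ll ->]]]] /=; rewrite le_eqVlt => /predU1P[<-|s0].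
    by rewrite mul0r.
  have -> : s *: t - l = s *: (t - s^-1 *: l).
    by rewrite scalerBr scalerA divff ?scale1r ?gt_eqF.
  by rewrite normrZ gtr0_norm// ler_pM2l// dTL//; exact: LZ.
have ns : sublinear (fun x : X => `|x|).
  split=> [x y|a x a0]; first exact: ler_normD.
  by rewrite normrZ gtr0_norm.
have [f [fn fW]] := hahn_banach_cone ns cW Wn.
exists f; split=> [x|l Ll|t Tt].
- by rewrite ler_norml fn andbT lerNl -linearN -normrN fn.
- have fL l' : L l' -> 0 <= f (- l').
    move=> Ll'; apply: (fW (- l', 0)).
    by exists 0, t0, l'; split=> //; rewrite scale0r mul0r sub0r.
  have := fL _ (LZ (-1) _ Ll); have := fL _ Ll.
  by rewrite scaleN1r opprK linearN/=; lra.
- apply: (fW (t, e)); exists 1, t, 0; split=> //.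
  by rewrite scale1r mul1r subr0.
Qed.

(** * Functionals on C(K) for scattered K *)

Lemma compact_sub_chain (K : topologicalType) (E : set K) (F : set (set K)) :
  compact E -> (forall U, F U -> open U) -> total_on F subset -> F !=set0 ->
  E `<=` \bigcup_(U in F) U -> exists2 U, F U & E `<=` U.
Proof.
move=> cE oF tF [U0 FU0] EF; apply: contrapT => noU.
have FF : Filter (filter_from F (fun U => E `\` U)).
  apply: filter_from_filter; first by exists U0.
  move=> U V FU FV; have [UV|VU] := tF _ _ FU FV.
    by exists V => // x [Ex nVx]; split; split=> // /UV.
  by exists U => // x [Ex nUx]; split; split=> // /VU.
have PF : ProperFilter (filter_from F (fun U => E `\` U)).
  apply: filter_from_proper => U FU; apply: contrapT => E0; apply: noU.
  exists U => // x Ex; apply: contrapT => nUx; apply: E0.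
  by exists x.
have [|p [Ep pF]] := cE _ PF; first by exists U0 => // x [].
have [U FU Up] := EF p Ep.
have [||x [[_ nUx] /nUx]//] := pF (E `\` U) U; first by exists U.
by apply: open_nbhs_nbhs; split=> //; exact: oF.
Qed.

Section continuous_functions_on_compact.
Context (R : realType) (K : topologicalType) (cK : compact [set: K]).
Context (hK : hausdorff_space K).
Local Notation CK := (continuous_functions R cK).
Local Coercion cfun_eval : continuous_functions >-> Funclass.
Implicit Types (f g h : CK) (S : seq K).

Lemma le_cfun_norm f x : `|f x| <= `|f|.
Proof. exact: le_sup_norm. Qed.

Lemma cfun_norm_le f (M : R) : 0 <= M -> (forall x, `|f x| <= M) -> `|f| <= M.
Proof. exact: sup_norm_le. Qed.

Lemma cfun_sum (I : Type) (s : seq I) (F : I -> CK) x :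
  (\sum_(i <- s) F i) x = \sum_(i <- s) F i x.
Proof. by elim/big_rec2: _ => // i _ y _ <-. Qed.

Lemma cfun_mul_continuous f g : continuous (fun x => f x * g x).
Proof. by move=> x; apply: cvgM; exact: cfun_continuous. Qed.

Definition cfun_mul f g : CK := mk_cfun cK (@cfun_mul_continuous f g).

Lemma cfun_urysohn (A B : set K) : closed A -> closed B -> A `&` B = set0 ->
  exists f, [/\ forall x, 0 <= f x <= 1, forall x, A x -> f x = 0 &
    forall x, B x -> f x = 1].
Proof.
move=> clA clB AB0.
have /uniform_separatorP-/(_ R)[f [cf f01 fA fB]] :=
  normal_uniform_separator (compact_normal hK cK) clA clB AB0.
exists (mk_cfun cK cf); split=> x.
- by have := f01 (f x) (ex_intro2 _ _ x I erefl); rewrite /= in_itv.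
- by move=> Ax; apply: fA; exists x.
- by move=> Bx; apply: fB; exists x.
Qed.

(** [h'] is [h] minus its truncation to the interval from [- d] to [d]. *)
Lemma cfun_shrink h (d : R) : 0 <= d -> exists h', [/\ `|h - h'| <= d,
  forall x, `|h' x| <= `|h x| & forall x, `|h x| <= d -> h' x = 0].
Proof.
move=> d0.
have ch' : continuous (fun x => h x - (`|h x + d| - `|h x - d|) / 2).
  move=> x; have hx := @cfun_continuous _ _ _ h x.
  apply: cvgB => //; apply: cvgM; last exact: cvg_cst.
  by apply: cvgB; apply: cvg_norm; [apply: cvgD|apply: cvgB] => //;
    exact: cvg_cst.
exists (mk_cfun cK ch'); split.
- apply: cfun_norm_le => // x; rewrite [X in `|X|](_ : _ =
    h x - (h x - (`|h x + d| - `|h x - d|) / 2)) // ler_norml.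
  by case: (ger0P (h x + d)); case: (ger0P (h x - d)) => ? ?; lra.
- move=> x; rewrite [X in `|X| <= _](_ : _ =
    h x - (`|h x + d| - `|h x - d|) / 2)// ler_norml.
  by case: (ger0P (h x + d)); case: (ger0P (h x - d)); case: (ger0P (h x));
    move=> ? ? ?; lra.
- move=> x; rewrite ler_norml => /andP[? ?].
  rewrite [LHS](_ : _ = h x - (`|h x + d| - `|h x - d|) / 2)//.
  by case: (ger0P (h x + d)); case: (ger0P (h x - d)) => ? ?; lra.
Qed.

Section atomicity.
Context (mu : {scalar CK}).
Context (mu1 : forall f, `|mu f| <= `|f|).

(** The part of [mu] that lives on [W] is, up to any [e], carried by finitely
    many points: the set [S] carries all but [e] of its variation. *)
Definition finitely_carried (W : set K) : Prop := forall e : R, 0 < e ->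
  exists S, forall h, `|h| <= 1 -> (forall x, ~ W x -> h x = 0) ->
    (forall x, x \in S -> h x = 0) -> `|mu h| <= e.

(** Let [U] be the union of the chain.  The supremum of [mu] over the unit ball of
    functions vanishing off [U] is almost attained at a function [h1] vanishing
    off a compact subset [E] of [U], and [E] lies in one member [W] of the chain.
    A function in that ball that vanishes on [E] has small value, because adding
    it to [h1] or subtracting it from [h1] stays in the ball.  Hence only the
    part of [mu] on [W] matters. *)
Lemma finitely_carried_bigcup (F : set (set K)) :
  (forall W, F W -> open W /\ finitely_carried W) -> total_on F subset ->
  finitely_carried (\bigcup_(W in F) W).
Proof.
move=> FP tF e e0.
have [F0|/set0P/negP/negPn/eqP F0] := pselect (F !=set0); last first.
  exists [::] => h _ h0 _; suff -> : h = 0 by rewrite linear0 normr0 ltW.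
  by apply: cfunP => x; apply: h0; rewrite F0 bigcup_set0.
pose U := \bigcup_(W in F) W.
pose B := [set mu h | h in
  [set h : CK | `|h| <= 1 /\ forall x, ~ U x -> h x = 0]].
have Bub : has_ubound B.
  exists 1 => _ [h [h1 _] <-]; apply: le_trans (ler_norm _) _.
  exact: le_trans (mu1 h) h1.
have B0 : B !=set0.
  exists (mu 0), 0 => //; split=> //; first by rewrite normr0.
pose d := e / 3; have d0 : 0 < d by rewrite divr_gt0.
have [_ [h0 [h01 h0U] <-] h0s] := sup_adherent d0 (conj B0 Bub).
have [h1 [h01d h1h0 h1E]] := cfun_shrink h0 (ltW d0).
pose E := [set x | d <= `|h0 x|].
have clE : closed E.
  apply: (preimage_closed (f := fun x => `|h0 x|) _ (@closed_ge _ d)) => x _.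
  by apply: cvg_norm; exact: cfun_continuous.
have EU : E `<=` U.
  move=> x Ex; apply: contrapT => /h0U h0x; move: Ex.
  by rewrite /E /= h0x normr0 leNgt d0.
have cE : compact E by apply: subclosed_compact cK _.
have [W FW EW] := compact_sub_chain cE (fun W FW => (FP W FW).1) tF F0 EU.
have [oW gW] := FP W FW.
(* [chi] splits [h] into a part vanishing off [W] and a part vanishing on [E]. *)
have [chi [chi01 chiW chiE]] : exists f, [/\ forall x, 0 <= f x <= 1,
    forall x, ~ W x -> f x = 0 & forall x, E x -> f x = 1].
  apply: cfun_urysohn => //; first exact: open_closedC.
  by rewrite -subset0 => x [nWx /EW].
have mul_le1 (a b : R) : `|a| <= 1 -> 0 <= b <= 1 -> `|a * b| <= 1.
  by move=> a1 /andP[b0 b1]; rewrite normrM (ger0_norm b0) mulr_ile1.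
have [S Sd] := gW d d0; exists S => h h1' hU hS.
have hb x : `|h x| <= 1 := le_trans (le_cfun_norm h x) h1'.
have [g gE ->] : exists2 g : CK, (forall x, g x = h x * (1 - chi x)) &
    h = cfun_mul h chi + g.
  exists (h - cfun_mul h chi); last by rewrite addrC subrK.
  by move=> x; rewrite mulrBr mulr1.
have mu_hchi : `|mu (cfun_mul h chi)| <= d.
  apply: Sd => [|x nWx|x xS].
  - apply: cfun_norm_le => // x; rewrite [X in `|X|](_ : _ = h x * chi x)//.
    exact: mul_le1.
  - by rewrite [LHS](_ : _ = h x * chi x)// chiW// mulr0.
  - by rewrite [LHS](_ : _ = h x * chi x)// hS// mul0r.
have gb x : `|g x| <= 1.
  have /andP[c0 c1] := chi01 x.
  by rewrite gE mul_le1// subr_ge0 c1 lerBlDr lerDl.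
have h1b x : `|h1 x| <= 1.
  by rewrite (le_trans (h1h0 x))// (le_trans (le_cfun_norm h0 x)).
have h1g (k : CK) :
    (forall x, k x = h1 x + g x) \/ (forall x, k x = h1 x - g x) ->
    mu k <= sup B.
  move=> kE; apply: ub_le_sup => //; exists k => //; split.
    apply: cfun_norm_le => // x; have [Ex|nEx] := pselect (E x).
      have gx : g x = 0 by rewrite gE chiE// subrr mulr0.
      by case: kE => ->; rewrite gx ?addr0 ?subr0.
    have h1x : h1 x = 0 by apply: h1E; rewrite leNgt; apply/negP => /ltW.
    by case: kE => ->; rewrite h1x ?add0r ?sub0r ?normrN.
  move=> x nUx; have hx := hU x nUx.
  have gx : g x = 0 by rewrite gE hx mul0r.
  have h1x : h1 x = 0.
    by apply: h1E; rewrite h0U// normr0 ltW.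
  by case: kE => ->; rewrite gx h1x ?addr0 ?subr0.
have mup : mu (h1 + g) <= sup B by apply: h1g; left.
have mum : mu (h1 - g) <= sup B by apply: h1g; right.
have muh : mu (h0 - h1) <= d.
  by apply: le_trans (ler_norm _) _; exact: le_trans (mu1 _) h01d.
move: mup mum muh; rewrite !linearD !linearN /= => mup mum muh.
have := ler_normD (mu (cfun_mul h chi)) (mu g).
have : `|mu g| <= d + d by rewrite ler_norml; lra.
have : d + d + d = e by rewrite /d; lra.
lra.
Qed.

(** A maximal finitely carried open set [A] is the whole space: otherwise its
    complement has an isolated point [x], and [A] can be enlarged by a
    neighbourhood of [x], at the price of adding [x] to the finite sets. *)
Lemma scattered_finitely_carried : scattered_space K -> finitely_carried setT.
Proof.
move=> sK.
have [F FP tF|A [[oA gA] maxA]] :=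
    @Zorn_bigcup K [set W | open W /\ finitely_carried W].
  split; last exact: finitely_carried_bigcup.
  by apply: bigcup_open => W /FP[].
have [AT|AT] := pselect (A = setT); first by rewrite -AT.
have /sK[x [/set_mem nAx [V Vx VA]]] : ~` A !=set0.
  by apply/set0P/eqP => A0; apply: AT; rewrite -[A]setCK A0 setC0.
have Vx' : V° x by [].
exfalso; apply: (maxA (A `|` V°)).
  split; first exact: subsetUl.
  by move=> /(_ x) /(_ (or_intror Vx')).
split; first by apply: openU => //; exact: open_interior.
move=> e e0; have [S Se] := gA e e0; exists (x :: S) => h h1 hA hS.
apply: Se => // [y nAy|y yS]; last by apply: hS; rewrite inE yS orbT.
have [Vy|nVy] := pselect (V° y); last by apply: hA => -[].
have : (V `&` ~` A) y by split=> //; exact: nbhs_singleton.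
by rewrite VA => ->; apply: hS; rewrite inE eqxx.
Qed.

(** The bound on the sum makes interpolation on [S] an operator of norm at most
    1, whatever the number of points.  To add a point [x], the old functions are
    multiplied by [1 - phi], where [phi] is 1 at [x] and 0 on [S]. *)
Lemma finite_interpolation S : exists s : seq (CK * K),
  [/\ forall g x, x \in S -> \sum_(p <- s) g p.2 * p.1 x = g x,
      forall p x, p \in s -> 0 <= p.1 x &
      forall x, \sum_(p <- s) p.1 x <= 1].
Proof.
elim: S => [|x S [s [sg s0 s1]]].
  by exists [::]; split=> // x; rewrite big_nil.
have [xS|xS] := boolP (x \in S).
  by exists s; split=> // g y; rewrite inE => /predU1P[->|]; exact: sg.
have clF (A : set K) : finite_set A -> closed A.
  by move: A; apply/accessible_finite_set_closed; exact: hausdorff_accessible.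
have [|||phi [phi01 phiS phix]] := @cfun_urysohn [set` S] [set x].
- by apply: clF; exact: finite_seq.
- by apply: clF; exact: finite_set1.
- by rewrite -subset0 => y [/= yS yx]; rewrite yx (negPf xS) in yS.
have chic : continuous (fun y => 1 - phi y).
  by move=> y; apply: cvgB; [exact: cvg_cst|exact: cfun_continuous].
pose chi : CK := mk_cfun cK chic.
exists ((phi, x) :: [seq (cfun_mul p.1 chi, p.2) | p <- s]); split.
- move=> g y; rewrite inE big_cons big_map.
  rewrite (eq_bigr (fun p : CK * K => g p.2 * p.1 y * (1 - phi y))); last first.
    by move=> p _; exact: mulrA.
  rewrite -big_distrl/= => /predU1P[->|yS].
    by rewrite phix// subrr mulr0 addr0 mulr1.
  by rewrite phiS// mulr0 add0r subr0 mulr1 sg.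
- move=> p y; rewrite inE => /predU1P[->|/mapP[q qs ->]] /=.
    by have /andP[] := phi01 y.
  rewrite [leRHS](_ : _ = q.1 y * (1 - phi y))// mulr_ge0 ?s0// subr_ge0.
  by have /andP[] := phi01 y.
- move=> y; rewrite big_cons big_map.
  rewrite (eq_bigr (fun p : CK * K => p.1 y * (1 - phi y)))//.
  rewrite -big_distrl/= -lerBrDl ler_piMl//.
  by rewrite subr_ge0; have /andP[] := phi01 y.
Qed.

(** If [S] carries all but [e / 2] of [mu], subtract from [g] its interpolation on
    [S]: the difference vanishes on [S] and has norm at most twice that of [g]. *)
Lemma atomic_approximation (e : R) : scattered_space K -> 0 < e ->
  exists s : seq (R * K), forall g,
    `|mu g - \sum_(p <- s) p.1 * g p.2| <= e * `|g|.
Proof.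
move=> sK e0.
have e2 : 0 < e / 2 by rewrite divr_gt0.
have [S SP] := scattered_finitely_carried sK e2.
have [s [sS s0 s1]] := finite_interpolation S.
exists [seq (mu p.1, p.2) | p <- s] => g; rewrite big_map.
have [h hE ->] : exists2 h : CK,
    (forall x, h x = g x - \sum_(p <- s) g p.2 * p.1 x) &
    mu g - \sum_(p <- s) mu p.1 * g p.2 = mu h.
  exists (g - \sum_(p <- s) g p.2 *: p.1) => [x|].
    by rewrite [LHS](_ : _ = g x - (\sum_(p <- s) g p.2 *: p.1) x)// cfun_sum.
  rewrite linearB (linear_sum mu); congr (_ - _); apply: eq_bigr => p _.
  by rewrite linearZ/= mulrC.
have hS x : x \in S -> h x = 0 by move=> xS; rewrite hE sS// subrr.
have hn : `|h| <= 2 * `|g|.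
  apply: cfun_norm_le => [|x]; first by rewrite mulr_ge0.
  rewrite hE mulrDl !mul1r (le_trans (ler_normB _ _))// lerD ?le_cfun_norm//.
  apply: le_trans (ler_norm_sum _ _ _) _.
  rewrite -[leRHS]mulr1; apply: le_trans (ler_wpM2l (normr_ge0 g) (s1 x)).
  rewrite big_distrr/= big_seq [leRHS]big_seq; apply: ler_sum => p ps.
  by rewrite normrM (ger0_norm (s0 _ _ ps)) ler_wpM2r ?s0// le_cfun_norm.
have [g0|g0] := eqVneq `|g| 0.
  have h0 : h = 0.
    apply/normr0_eq0/le_anti.
    by rewrite normr_ge0 andbT (le_trans hn)// g0 mulr0.
  by rewrite h0 linear0 normr0 g0 mulr0.
have g_gt0 : 0 < 2 * `|g| by rewrite mulr_gt0// lt0r g0 normr_ge0.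
have := SP ((2 * `|g|)^-1 *: h).
rewrite linearZ/= normrM gtr0_norm ?invr_gt0// ler_pdivrMl//.
have -> : 2 * `|g| * (e / 2) = e * `|g| by lra.
apply=> [|x /(_ I)//|x xS].
  by rewrite normrZ gtr0_norm ?invr_gt0// ler_pdivrMl// mulr1.
by rewrite [LHS](_ : _ = (2 * `|g|)^-1 * h x)// hS// mulr0.
Qed.

Lemma rational_approximation (s : seq (R * K)) (e : R) : 0 < e ->
  exists t : seq (rat * K), forall g,
    `|\sum_(p <- s) p.1 * g p.2 - \sum_(p <- t) ratr p.1 * g p.2| <= e * `|g|.
Proof.
elim: s e => [|[a x] s IHs] e e0.
  by exists [::] => g; rewrite !big_nil subr0 normr0 mulr_ge0// ltW.
have e2 : 0 < e / 2 by rewrite divr_gt0.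
have [t tP] := IHs _ e2.
have [|q qa] := @rat_in_itvoo R (a - e / 2) (a + e / 2); first by lra.
exists ((q, x) :: t) => g; rewrite !big_cons /= opprD addrACA -mulrBl.
have -> : e * `|g| = e / 2 * `|g| + e / 2 * `|g| by lra.
rewrite (le_trans (ler_normD _ _))// lerD// normrM.
rewrite ler_pM// ?le_cfun_norm//.
by move: qa; rewrite in_itv/= => /andP[? ?]; rewrite ler_norml; lra.
Qed.

End atomicity.

(** The combinations of evaluations with coefficients [q] are parametrized by a
    compact, countably tight space [Z].  For [q] empty, [Z] is any finite nonempty
    space; taking [bool] instead of [K] covers the case of empty [K]. *)
Lemma atomic_parametrization (q : seq rat) : countably_tight K ->
  exists (Z : topologicalType) (ev : Z -> CK -> R),
    [/\ compact [set: Z], countably_tight Z, forall f, continuous (ev^~ f) &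
        forall t : seq (rat * K), map fst t = q ->
          exists z, forall f, ev z f = \sum_(p <- t) ratr p.1 * f p.2].
Proof.
move=> tK; elim: q => [|a q [Z [ev [cZ tZ evc evP]]]].
  exists bool, (fun _ _ => 0); split.
  - exact: bool_compact.
  - by move=> A a Aa; exists A; split=> //; exact: countableP.
  - by move=> f z; exact: cvg_cst.
  - by case=> // _; exists true => f; rewrite big_nil.
exists (K * Z)%type, (fun z f => ratr a * f z.1 + ev z.2 f); split.
- by rewrite -setXTT; exact: compact_setX.
- exact: countably_tight_prod.
- move=> f [x z]; apply: cvgD.
    apply: cvgM; first exact: cvg_cst.
    apply: (@cvg_comp _ _ _ fst f); first exact: cvg_fst.
    exact: cfun_continuous.
  apply: (@cvg_comp _ _ _ snd (ev^~ f)); first exact: cvg_snd.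
  exact: evc.
- case=> // -[b x] t [-> /evP[z zP]]; exists (x, z) => f.
  by rewrite big_cons zP.
Qed.

End continuous_functions_on_compact.

(** * Property (C) *)

Definition countable_intersection_property (X : Type) (T : set (set X)) :
    Prop :=
  forall G, G `<=` T -> countable G -> \bigcap_(A in G) A !=set0.

Local Notation norm_ball := (closed_ball_ Num.norm).

Lemma norm_ball_convex (R : realType) (X : normedModType R) (u : X) (e : R) :
  convex_set (norm_ball u e).
Proof.
apply/convex_setP => x y t xu yu /andP[t0 t1]; rewrite /closed_ball_ /=.
have -> : u - (t *: x + (1 - t) *: y) = t *: (u - x) + (1 - t) *: (u - y).
  by rewrite !scalerBr addrACA -opprD -scalerDl addrCA subrr addr0 scale1r.
apply: le_trans (ler_normD _ _) _.
rewrite !normrZ ger0_norm// ger0_norm ?subr_ge0//.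
have -> : e = t * e + (1 - t) * e by lra.
by rewrite lerD// ler_wpM2l// subr_ge0.
Qed.

Lemma linear_combination_approximation (R : realType) (X : normedModType R)
    (c : nat -> X) (s : seq (R * nat)) (e : R) : 0 < e ->
  exists t : seq (rat * nat),
    `|\sum_(p <- s) p.1 *: c p.2 - \sum_(p <- t) ratr p.1 *: c p.2| <= e.
Proof.
elim: s e => [|[a n] s IHs] e e0.
  by exists [::]; rewrite !big_nil subr0 normr0 ltW.
have e2 : 0 < e / 2 by rewrite divr_gt0.
have [t tP] := IHs _ e2.
pose d := e / 2 / (1 + `|c n|).
have c1 : 0 < 1 + `|c n| by rewrite ltr_pwDl.
have d0 : 0 < d by rewrite divr_gt0.
have [|q qa] := @rat_in_itvoo R (a - d) (a + d); first by lra.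
exists ((q, n) :: t); rewrite !big_cons /= opprD addrACA -scalerBl.
rewrite [e]splitr (le_trans (ler_normD _ _))// lerD// normrZ.
have -> : e / 2 = d * (1 + `|c n|) by rewrite /d divfK// gt_eqF.
rewrite ler_pM//; last by rewrite lerDr.
by move: qa; rewrite in_itv/= => /andP[? ?]; rewrite ler_norml; lra.
Qed.

(** The rational combinations of [C] form a countable set, so that a single
    countable part [G] of [T] has its intersection at distance at least [e] from
    all of them, hence from their closure, which contains the span of [C]. *)
Lemma far_from_countable_functional (R : realType) (X : normedModType R)
    (T : set (set X)) (e : R) (C : set X) :
  (forall A, T A -> convex_set A) -> countable_intersection_property T ->
  (forall u, exists G, [/\ G `<=` T, countable G &
     forall t, (\bigcap_(A in G) A) t -> e <= `|t - u|]) ->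
  countable C ->
  exists mu : {scalar X}, [/\ forall x, `|mu x| <= `|x|,
    forall x, C x -> mu x = 0 &
    exists G, [/\ G `<=` T, countable G &
      forall t, (\bigcap_(A in G) A) t -> e <= mu t]].
Proof.
move=> convT cipT far /countable_injP[i injC].
have /choice[c cP] : forall n, exists x, forall y, C y -> i y = n -> x = y.
  move=> n; have [[x Cx ix]|nx] := pselect (exists2 x, C x & i x = n).
    by exists x => y Cy iy; apply: injC; rewrite ?inE// ix.
  by exists 0 => y Cy iy; case: nx; exists y.
pose u (t : seq (rat * nat)) : X := \sum_(p <- t) ratr p.1 *: c p.2.
have [E [Efar ET cE]] := @countable_gather _ _ [set: seq (rat * nat)] T
  (fun t G => forall x, (\bigcap_(A in G) A) x -> e <= `|x - u t|)
  (countableP _) (fun t _ => far (u t)).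
pose G := \bigcup_(t in setT) E t.
pose L : set X :=
  [set x | exists s : seq (R * nat), x = \sum_(p <- s) p.1 *: c p.2].
have [||||x l Gx [s ->]|mu [mu1 muL muG]] :=
  @separate_convex_subspace R X (\bigcap_(A in G) A) L e.
- apply/convex_setP => x y t Gx Gy t01 A GA.
  have /convex_setP cA := convT A (ET A GA).
  by apply: cA => //; [exact: Gx|exact: Gy].
- exact: cipT.
- by exists [::]; rewrite big_nil.
- move=> a _ _ [s ->] [s' ->]; exists ([seq (a * p.1, p.2) | p <- s] ++ s').
  rewrite big_cat big_map /= scaler_sumr; congr (_ + _).
  by apply: eq_bigr => p _; rewrite scalerA.
- apply/ler_addgt0Pr => d d0.
  have [t td] := linear_combination_approximation c s d0.
  apply: (@le_trans _ _ `|x - u t|).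
    by apply: (Efar t I) => A EA; apply: Gx; exists t.
  rewrite -(subrKA (\sum_(p <- s) p.1 *: c p.2)) (le_trans (ler_normD _ _))//.
  by rewrite lerD2l.
exists mu; split=> //; last by exists G.
move=> x Cx; apply: muL; exists [:: (1, i x)].
by rewrite big_seq1 scale1r (cP _ x).
Qed.

Section corson.
Context (R : realType) (K : topologicalType) (cK : compact [set: K]).
Context (hK : hausdorff_space K) (sK : scattered_space K).
Context (tK : countably_tight K).
Local Notation CK := (continuous_functions R cK).
Local Coercion cfun_eval : continuous_functions >-> Funclass.

(** Otherwise every ball of radius [e] misses the intersection of some countable
    part of [T].  The set [M] below then satisfies both hypotheses of
    [no_countably_separating_duality], once the pigeonhole principle has fixed a
    bound for the functions and a list of coefficients for the functionals. *)
Lemma cip_near_point (T : set (set CK)) (e : R) :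
  (forall A, T A -> convex_set A) -> countable_intersection_property T ->
  0 < e ->
  exists u, countable_intersection_property (T `|` [set norm_ball u e]).
Proof.
move=> convT cipT e0; apply: contrapT => noU.
have far u : exists G, [/\ G `<=` T, countable G &
    forall t, (\bigcap_(A in G) A) t -> e <= `|t - u|].
  apply: contrapT => noG; apply: noU; exists u => G GT cG.
  apply: contrapT => G0; apply: noG; exists (G `&` T); split.
  - exact: subIsetr.
  - by apply: sub_countable cG; apply: subset_card_le; exact: subIsetl.
  - move=> t tG; rewrite leNgt; apply/negP => /ltW tu; apply: G0; exists t.
    move=> A GA; have [TA|->] := GT _ GA; first exact: tG.
    by rewrite /closed_ball_ /= distrC.
pose M : set {scalar CK} := [set mu : {scalar CK} |
  (forall x, `|mu x| <= `|x|) /\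
  exists G, [/\ G `<=` T, countable G &
    forall t, (\bigcap_(A in G) A) t -> e <= mu t]].
have above (C : set {scalar CK}) : C `<=` M -> countable C ->
    exists f : CK, forall mu, C mu -> e <= mu f.
  move=> CM cC.
  have [|E [EC ET cE]] := @countable_gather _ _ C T
    (fun mu G => forall t, (\bigcap_(A in G) A) t -> e <= mu t) cC.
    by move=> mu /CM[].
  have [f fE] := cipT _ ET cE.
  exists f => mu Cmu; apply: (EC mu Cmu) => A EA; apply: fE.
  by exists mu.
have [||N _ aboveN] := @countable_pigeonhole _ _ [set: nat] M
    (fun N C => exists2 f : CK, `|f| <= N%:R & forall mu, C mu -> e <= mu f)
    (countableP _).
- by move=> N B C BC [f fN fC]; exists f => // mu /BC; exact: fC.
- move=> C CM cC; have [f fC] := above C CM cC.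
  exists (Num.truncn `|f|).+1 => //; exists f => //.
  exact/ltW/truncnS_gt.
(* An error of [d] in the norm of the functionals changes their values on
   functions bounded by [N] by at most [e / 4]. *)
pose d := e / 4 / N.+1%:R.
have d0 : 0 < d by rewrite !divr_gt0.
have dN (f : CK) : `|f| <= N%:R -> d * `|f| <= e / 4.
  move=> fN; rewrite /d mulrAC ler_pdivrMr// ler_wpM2l// ?divr_ge0//.
    exact: ltW.
  by rewrite (le_trans fN)// ler_nat.
have [||q _ belowq] := @countable_pigeonhole _ _ [set: seq rat] [set: CK]
    (fun q C => exists mu : {scalar CK}, [/\ M mu, forall f, C f -> mu f = 0 &
      exists2 t : seq (rat * K), map fst t = q & forall g : CK,
        `|mu g - \sum_(p <- t) ratr p.1 * g p.2| <= d * `|g|]) (countableP _).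
- move=> q B C BC [mu [Mmu muC mut]]; exists mu; split=> // f /BC.
  exact: muC.
- move=> C _ cC.
  have [mu [mu1 muC muT]] := far_from_countable_functional convT cipT far cC.
  have d2 : 0 < d / 2 by rewrite divr_gt0.
  have [s sP] := atomic_approximation hK mu1 sK d2.
  have [t tP] := rational_approximation cK s d2.
  exists (map fst t) => //; exists mu; split=> //; exists t => // g.
  rewrite -(subrKA (\sum_(p <- s) p.1 * g p.2)) (le_trans (ler_normD _ _))//.
  have -> : d * `|g| = d / 2 * `|g| + d / 2 * `|g| by lra.
  exact: lerD.
have [Z [ev [cZ tZ evc evP]]] := @atomic_parametrization R K cK hK q tK.
pose A : set Z := [set z | exists2 mu, M mu &
  forall g : CK, `|mu g - ev z g| <= d * `|g|].
pose F : set (Z -> R) := [set ev^~ f | f in [set f : CK | `|f| <= N%:R]].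
apply: (@no_countably_separating_duality R Z A F (e / 4) (e * 3 / 4)) => //.
- by move=> _ [f _ <-]; exact: evc.
- by lra.
- move=> C CA cC.
  have /choice[m mP] : forall z, exists mu : {scalar CK}, C z ->
      M mu /\ forall g : CK, `|mu g - ev z g| <= d * `|g|.
    move=> z; have [/CA[mu Mmu muz]|nCz] := pselect (C z); first by exists mu.
    by exists \0.
  have [||f fN fC] := aboveN (m @` C).
  - by move=> _ [z /mP[Mm _] <-].
  - exact: sub_countable (card_image_le _ _) cC.
  exists (ev^~ f); first by exists f.
  move=> z Cz; have [_ /(_ f) mz] := mP z Cz.
  have := fC (m z) (imageP _ Cz); have := dN f fN.
  by move: mz; rewrite ler_norml; lra.
- move=> G GF cG.
  have /choice[h hP] : forall phi, exists f : CK, G phi ->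
      `|f| <= N%:R /\ ev^~ f = phi.
    move=> phi; have [/GF[f fN fphi]|nG] := pselect (G phi); first by exists f.
    by exists 0.
  have [//||mu [Mmu muC [t tq tP]]] := belowq (h @` G).
    exact: sub_countable (card_image_le _ _) cG.
  have [z zP] := evP t tq; exists z.
    by exists mu => // g; rewrite zP.
  move=> phi Gphi; have [hN <-] := hP phi Gphi.
  have := tP (h phi); rewrite -zP (muC _ (imageP _ Gphi)) sub0r normrN.
  by have := dN _ hN; rewrite ler_norml; lra.
Qed.

(** Balls of radii 1, 1/2, 1/3, ... are added one after the other; their finite
    intersections, each meeting every member of [T], generate a Cauchy filter
    with limit in every member of [T]. *)
Lemma corson_property (T : set (set CK)) :
  (forall A, T A -> convex_set A /\ closed A) ->
  countable_intersection_property T ->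
  exists u, forall A, T A -> A u.
Proof.
move=> TP cipT.
have /choice[pick pickP] : forall Tn : set (set CK) * nat, exists u,
    (forall A, Tn.1 A -> convex_set A) ->
    countable_intersection_property Tn.1 ->
    countable_intersection_property (Tn.1 `|` [set norm_ball u Tn.2.+1%:R^-1]).
  move=> [S n] /=.
  have [[convS cipS]|nS] := pselect ((forall A, S A -> convex_set A) /\
      countable_intersection_property S).
    have [|u uP] := @cip_near_point S n.+1%:R^-1 convS cipS.
      by rewrite invr_gt0.
    by exists u.
  by exists 0 => *; case: nS.
pose fam := fix fam n := if n is n'.+1 then
  fam n' `|` [set norm_ball (pick (fam n', n')) n'.+1%:R^-1] else T.
pose u n := pick (fam n, n).
have famP n : (forall A, fam n A -> convex_set A) /\
    countable_intersection_property (fam n).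
  elim: n => [|n [convn cipn]] /=; first by split=> // A /TP[].
  split; last exact: (pickP (fam n, n)).
  by move=> A [/convn//|->]; exact: norm_ball_convex.
have famT n : T `<=` fam n by elim: n => //= n IHn A /IHn; left.
have famu n k : (k < n)%N -> fam n (norm_ball (u k) k.+1%:R^-1).
  elim: n => // n IHn; rewrite ltnS leq_eqVlt => /predU1P[->|/IHn].
    by right.
  by left.
pose B n : set CK :=
  [set x | forall k, (k < n)%N -> norm_ball (u k) k.+1%:R^-1 x].
have meetB n A : T A -> exists2 x, A x & B n x.
  move=> TA.
  have [||x xG] := (famP n).2
    (A |` [set norm_ball (u k) k.+1%:R^-1 | k in `I_n]).
  - by move=> _ [->|[k kn <-]]; [exact: famT|exact: famu].
  - apply: finite_set_countable; rewrite finite_setU; split=> //.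
    exact: finite_image.
  by exists x => [|k kn]; apply: xG; [left|right; exists k].
have Bne n : B n !=set0.
  have [||x xG] := (famP n).2 [set norm_ball (u k) k.+1%:R^-1 | k in `I_n].
  - by move=> _ [k kn <-]; exact: famu.
  - by apply: finite_set_countable; exact: finite_image.
  by exists x => k kn; apply: xG; exists k.
have FF : Filter (filter_from [set: nat] B).
  apply: filter_from_filter; first by exists 0%N.
  move=> m n _ _; exists (maxn m n) => // x xB.
  by split=> k kn; apply: xB; rewrite leq_max kn ?orbT.
have PF : ProperFilter (filter_from [set: nat] B).
  by apply: filter_from_proper => n _; exact: Bne.
have cF : cauchy (filter_from [set: nat] B).
  apply: cauchy_exP => e e0.
  have [n ne] : exists n, n.+1%:R^-1 < e.
    exists (Num.truncn e^-1); rewrite invf_plt ?posrE//; exact: truncnS_gt.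
  exists (u n), n.+1 => // x /(_ n (ltnSn n)) xn.
  by rewrite -ball_normE /= (le_lt_trans xn).
have /cvg_ex[v Fv] := @cauchy_cvg CK _ PF cF.
exists v => A TA; apply: (TP A TA).2 => U /Fv[n _ BU].
by have [x Ax Bx] := meetB n A TA; exists x; split=> //; exact: BU.
Qed.

(** * Countable separation and separability *)

Lemma cfun_eval_continuous (x : K) : continuous (fun f : CK => f x).
Proof.
move=> f A /nbhs_ballP[e /= e0 eA]; apply/nbhs_ballP; exists e => // g.
rewrite -ball_normE /= => fg; apply: eA; rewrite -ball_normE /=.
exact: le_lt_trans (le_cfun_norm (f - g) x) fg.
Qed.

Lemma separable_CSP : separable_space K -> CSP CK.
Proof.
move=> [D cD dD] F FX sepF; apply: contrapT => noF0.
have nonsep G : G `<=` F -> countable G ->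
    exists2 x : CK, x != 0 & forall f, G f -> f x = 0.
  move=> GF cG; apply: contrapT => noX; apply: noF0; exists G; split=> // x x0.
  apply: contrapT => Gx; apply: noX; exists x => // f Gf.
  by apply/eqP; apply: contrapT => /negP fx; apply: Gx; exists f.
have [||p Dp pP] := @countable_pigeonhole _ _ D F
    (fun p G => exists2 x : CK, x p = 1 & forall f, G f -> f x = 0) cD.
- by move=> p B C BC [x xp xC]; exists x => // f /BC; exact: xC.
- move=> G GF cG; have [x x0 xG] := nonsep G GF cG.
  have [y xy] : exists y, x y != 0.
    apply: contrapT => nx; move/eqP: x0; apply; apply: cfunP => y.
    by apply/eqP; apply: contrapT => /negP xy; apply: nx; exists y.
  have [||p [/= xp Dp]] := dD [set y | x y != 0]; first by exists y.
    apply: (open_comp (f := x) (D := [set r | r != 0])) => [z _|].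
      exact: cfun_continuous.
    exact: open_neq.
  exists p => //; exists ((x p)^-1 *: x).
    by rewrite [LHS](_ : _ = (x p)^-1 * x p)// mulVf.
  by move=> f Gf; rewrite linearZ/= xG// mulr0.
pose T : set (set CK) := [set [set x : CK | x p = 1]] `|`
  [set [set x | f x = 0] | f in F].
have [||v vT] := @corson_property T.
- move=> _ [->|[f Ff <-]]; split.
  + apply/convex_setP => x y t xp yp _.
    suff : t * x p + (1 - t) * y p = 1 by [].
    by rewrite (xp : x p = 1) (yp : y p = 1); lra.
  + apply: (preimage_closed (f := fun x : CK => x p) _ (@closed_eq _ 1)) => x _.
    exact: cfun_eval_continuous.
  + apply/convex_setP => x y t /= xp yp _.
    by rewrite linearD !linearZ/= xp yp !mulr0 addr0.
  + apply: (preimage_closed (f := f) _ (@closed_eq _ 0)) => x _.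
    exact: FX.
- move=> G GT cG.
  have [|E [EG EF cE]] := @countable_gather _ _ G F
      (fun A H => forall x : CK, x p = 1 ->
        (forall f, H f -> f x = 0) -> A x) cG.
    move=> A /GT[->|[f Ff <-]].
      by exists set0; split=> //; exact: countable0.
    exists [set f]; split=> [_ ->//||x _]; first exact: countable1.
    exact.
  have [x xp xE] := pP _ EF cE; exists x => A GA; apply: (EG A GA) => // f Ef.
  by apply: xE; exists A.
have vp : v p = 1 by apply: (vT [set x : CK | x p = 1]); left.
have v0 : v != 0.
  by apply/eqP => v0; move/eqP: vp; rewrite v0 eq_sym oner_eq0.
have [f Ff] := sepF v v0; rewrite (_ : f v = 0) ?eqxx//.
by apply: (vT [set x | f x = 0]); right; exists f.
Qed.

Lemma CSP_separable : CSP CK -> separable_space K.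
Proof.
have ex_delta (x : K) : exists d : {scalar CK}, forall f : CK, d f = f x.
  pose d := fun f : CK => f x.
  have ld : linear_for *%R d by [].
  pose m := GRing.isLinear.Build R CK R *%R d ld.
  by pose dl : {scalar CK} := HB.pack d m; exists dl.
have [delta deltaE] := choice ex_delta.
move=> /(_ (range delta))[|f f0|F0 [F0d cF0 sepF0]].
- move=> _ [x _ <-]; rewrite /dual /=.
  rewrite (_ : (delta x : CK -> R) = fun f => cfun_eval f x); last exact/funext.
  exact: cfun_eval_continuous.
- have [x fx] : exists x, cfun_eval f x != 0.
    apply: contrapT => nx; move/eqP: f0; apply; apply: cfunP => x.
    by apply/eqP; apply: contrapT => /negP fx; apply: nx; exists x.
  by exists (delta x); [exists x|rewrite deltaE].
have [|E [EF _ cE]] := @countable_gather _ _ F0 [set: K]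
    (fun d D => exists2 x, D x & d = delta x) cF0.
  move=> d /F0d[x _ <-]; exists [set x]; split=> //.
  by exists x.
exists (\bigcup_(d in F0) E d) => // O [x Ox] oO; apply: contrapT => OE.
have clx : closed [set x].
  by move: [set x] (@finite_set1 _ x); apply/accessible_finite_set_closed;
    exact: hausdorff_accessible.
have [|f [_ fO fx]] := @cfun_urysohn R K cK hK _ _ (open_closedC oO) clx.
  by rewrite -subset0 => y [nOy yx]; apply: nOy; rewrite yx.
have f0 : f != 0.
  apply/eqP => f0; have := fx x erefl; rewrite f0 => /eqP.
  by rewrite eq_sym oner_eq0.
have [d F0d' ] := sepF0 f f0; have [y Ey ->] := EF d F0d'.
rewrite deltaE => /eqP; apply; apply: fO => Oy; apply: OE.
by exists y; split=> //; exists d.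
Qed.

End corson.

Theorem theorem3p6 (R : realType) (K : topologicalType)
    (cK : compact [set: K]) (hK : hausdorff_space K)
    (scatK : scattered_space K) (tightK : countably_tight K) :
  CSP (continuous_functions R cK) <-> separable_space K.
Proof.
split; first exact: CSP_separable.
exact: separable_CSP.
Qed.
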